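(* Let $0<s<d$ and $j\in\{1,\ldots,\varkappa\}$ be given. Then there exist constants $C>0$ and $0\le r<1$ such that for all $V\in\mathcal{G}(s,d)$ with $$s=\sum_{i=1}^{j}\dim(\mathcal{W}_0^i),\qquad V\cap\bigoplus_{i=j+1}^{\varkappa}\mathcal{W}_0^i=\{0\},$$ the following estimates hold: $$\measuredangle\Big(\Phi(n,0)V,\ \bigoplus_{i=1}^{j}\mathcal{W}_n^i\Big)\le\frac{C}{\theta_{\min}}\,r^n\qquad\text{for all } n\ge 1,$$ $$\Big|\alpha_s^{\mathrm{disc}}(n,V)-\alpha_s^{\mathrm{disc}}\Big(n,\bigoplus_{i=1}^{j}\mathcal{W}_0^i\Big)\Big|\le\frac{C}{n\,\theta_{\min}}\qquad\text{for all } n\ge 1,$$ where $\theta_{\min}=\theta_{\min}\big(V,\bigoplus_{i=j+1}^{\varkappa}\mathcal{W}_0^i\big)$ is the minimal principal angle between $V$ and $\bigoplus_{i=j+1}^{\varkappa}\mathcal{W}_0^i$. Further, the equality $$I_s^{\mathrm{disc}}(V)=I_s^{\mathrm{disc}}\Big(\bigoplus_{i=1}^{j}\mathcal{W}_0^i\Big)$$ holds.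
   Context: $\mathcal{G}(s,d)$ is the set of $s$-dimensional subspaces of $\mathbb{R}^d$; $\|\cdot\|$ is the Euclidean/spectral norm; $\mathcal{R}(P)$ and $\mathcal{N}(P)$ denote range and null space. Angles. For $V,W\in\mathcal{G}(s,d)$, $\measuredangle(V,W)\in[0,\frac{\pi}{2}]$ is the maximal principal angle: $\measuredangle(V,W)=\arccos(\sigma_s)$, where $\sigma_1\ge\dots\ge\sigma_s\ge0$ are the singular values of $V_B^\top W_B$ and the columns of $V_B,W_B\in\mathbb{R}^{d,s}$ are orthonormal bases of $V,W$. For nonzero subspaces $V,W$ (possibly of different dimension), the minimal principal angle is $\theta_{\min}(V,W)=\arccos\big(\max\{v^\top w: v\in V,\ w\in W,\ \|v\|=\|w\|=1\}\big)\in[0,\frac{\pi}{2}]$. Linear system. Consider $u_{n+1}=A_nu_n$, $n\in\mathbb{N}_0$, with invertible $A_n\in\mathbb{R}^{d,d}$ (in the paper $A_n=DF_n(x_n)$ is the variational equation along a fixed trajectory of $x_{n+1}=F_n(x_n)$ with $F_n\in C^1(\mathbb{R}^d,\mathbb{R}^d)$), such that $\sup_n\|A_n\|<\infty$ and $\sup_n\|A_n^{-1}\|<\infty$. The solution operator is $\Phi(n,m)=A_{n-1}\cdots A_m$ for $n>m$, $\Phi(n,n)=I_d$, $\Phi(n,m)=A_n^{-1}\cdots A_{m-1}^{-1}$ for $n<m$. Dichotomy data. By the spectral theorem for exponential dichotomies, there exist $\varkappa\le d$, numbers $$0=\sigma_{\varkappa+1}^+<\sigma_\varkappa^-\le\sigma_\varkappa^+<\sigma_{\varkappa-1}^-\le\sigma_{\varkappa-1}^+<\dots<\sigma_1^-\le\sigma_1^+$$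 (the dichotomy spectrum is $\bigcup_{i=1}^{\varkappa}[\sigma_i^-,\sigma_i^+]$) and projectors $P_n^i\in\mathbb{R}^{d,d}$, $n\in\mathbb{N}_0$, $i=1,\dots,\varkappa+1$, which are fixed, with the following properties. (i) For all $0\le m\le n$ and all $i$: $\Phi(n,m)P_m^i=P_n^i\Phi(n,m)$; $\{0\}=\mathcal{R}(P_n^{\varkappa+1})\subseteq\mathcal{R}(P_n^{\varkappa})\subseteq\dots\subseteq\mathcal{R}(P_n^1)=\mathbb{R}^d$; $\mathbb{R}^d=\mathcal{N}(P_n^{\varkappa+1})\supseteq\mathcal{N}(P_n^\varkappa)\supseteq\dots\supseteq\mathcal{N}(P_n^1)=\{0\}$. (ii) For each $i=1,\dots,\varkappa$ and every $0<\varepsilon<\sigma_i^--\sigma_{i+1}^+$ there is a constant $K_i(\varepsilon)$ such that for all $0\le m\le n$: $\|\Phi(n,m)P_m^{i+1}\|\le K_i(\varepsilon)(\sigma_{i+1}^++\varepsilon)^{n-m}$ and $\|\Phi(m,n)(I_d-P_n^{i+1})\|\le K_i(\varepsilon)(\sigma_i^--\varepsilon)^{m-n}$. Fibers: $\mathcal{W}_n^i=\mathcal{R}(P_n^i)\cap\mathcal{N}(P_n^{i+1})$, $i=1,\dots,\varkappa$, so that $\mathbb{R}^d=\bigoplus_{i=1}^{\varkappa}\mathcal{W}_n^i$. Angular averages and ranges: for $V\in\mathcal{G}(s,d)$ and $n\ge1$, $$\alpha_s^{\mathrm{disc}}(n,V)=\frac1n\sum_{k=1}^{n}\measuredangle(\Phi(k-1,0)V,\Phi(k,0)V),\qquad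 I_s^{\mathrm{disc}}(V)=\Big[\varliminf_{n\to\infty}\alpha_s^{\mathrm{disc}}(n,V),\ \varlimsup_{n\to\infty}\alpha_s^{\mathrm{disc}}(n,V)\Big].$$ *)

(* Defs.v *)
From HB Require Import structures.
From mathcomp Require Import all_boot all_order all_algebra.
From mathcomp Require Import all_classical all_reals all_analysis.

Set Implicit Arguments.
Unset Strict Implicit.
Unset Printing Implicit Defensive.

Import Order.TTheory GRing.Theory Num.Theory.
Local Open Scope classical_set_scope.
Local Open Scope ring_scope.

(* The norm `|_| that MathComp-Analysis puts on matrices is the maximum norm,
   hence the Euclidean and spectral norms below. *)
Definition dotv {R : realType} {d : nat} (v w : 'cV[R]_d) : R :=
  (v^T *m w) 0 0.

Definition norm2 {R : realType} {d : nat} (v : 'cV[R]_d) : R :=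
  Num.sqrt (dotv v v).

Definition specnorm {R : realType} {d : nat} (M : 'M[R]_d) : R :=
  sup [set norm2 (M *m x) | x in [set x : 'cV[R]_d | norm2 x <= 1]].

Definition mxlin {R : realType} {d p : nat} (M : 'M[R]_(d, p)) :
  'Hom('cV[R]_p, 'cV[R]_d) := linfun (mulmx M).

Definition mxrange {R : realType} {d p : nat} (M : 'M[R]_(d, p)) :
  {vspace 'cV[R]_d} := limg (mxlin M).

Definition mxnull {R : realType} {d p : nat} (M : 'M[R]_(d, p)) :
  {vspace 'cV[R]_p} := lker (mxlin M).

Definition mximage {R : realType} {d p : nat} (M : 'M[R]_(d, p))
  (V : {vspace 'cV[R]_p}) : {vspace 'cV[R]_d} := (mxlin M @: V)%VS.

Definition is_onbasis {R : realType} {d s : nat} (V : {vspace 'cV[R]_d})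
  (B : 'M[R]_(d, s)) : Prop := B^T *m B = 1%:M /\ mxrange B = V.

(* sv = [:: sigma_1; ...; sigma_s]: the square roots of the eigenvalues of
   M^T M, counted with multiplicity, in nonincreasing order. *)
Definition is_singular_values {R : realType} {s : nat} (M : 'M[R]_s)
  (sv : seq R) : Prop :=
  [/\ size sv = s, sorted >=%R sv, all (>= 0) sv &
      char_poly (M^T *m M) = \prod_(x <- sv) ('X - (x ^+ 2)%:P)].

(* The angle does not depend on the orthonormal bases VB, WB, so for V and W
   of dimension s > 0 the set below is a singleton; [xget] picks its element. *)
Definition max_angle {R : realType} {d : nat} (s : nat)
  (V W : {vspace 'cV[R]_d}) : R :=
  xget 0 [set t : R | exists (VB WB : 'M[R]_(d, s)) (sv : seq R),
    [/\ is_onbasis V VB, is_onbasis W WB,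
        is_singular_values (VB^T *m WB) sv & t = acos (nth 0 sv s.-1)]].

(* For nonzero V and W the supremum is attained. *)
Definition min_angle {R : realType} {d : nat} (V W : {vspace 'cV[R]_d}) : R :=
  acos (sup [set c : R | exists v w : 'cV[R]_d,
    [/\ v \in V, w \in W, norm2 v = 1, norm2 w = 1 & c = dotv v w]]).

(* A_(n-1) ... A_m for m <= n, and A_n^-1 ... A_(m-1)^-1 for n < m. *)
Definition Phi {R : realType} {d : nat} (A : nat -> 'M[R]_d) (n m : nat) :
  'M[R]_d :=
  if (m <= n)%N then \prod_(i <- rev (index_iota m n)) A i
  else \prod_(n <= i < m) invmx (A i).

Definition exp_dichotomy {R : realType} {d : nat} (A : nat -> 'M[R]_d) : Prop :=
  exists (K a b : R) (P : nat -> 'M[R]_d),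
    [/\ 0 < K, 0 < a < 1, 1 < b,
        forall n, P n *m P n = P n &
        forall m n, (m <= n)%N ->
          [/\ Phi A n m *m P m = P n *m Phi A n m,
              specnorm (Phi A n m *m P m) <= K * a ^+ (n - m) &
              specnorm (Phi A m n *m (1%:M - P n)) <= K * b ^- (n - m)]].

Definition dichotomy_spectrum {R : realType} {d : nat} (A : nat -> 'M[R]_d) :
  set R := [set l | 0 < l /\ ~ exp_dichotomy (fun n => l^-1 *: A n)].

(* sm i = sigma_i^-, sp i = sigma_i^+ and P n i = P_n^i; only the indices
   1 <= i <= k (1 <= i <= k.+1 for sp k.+1 and for P) are meaningful. *)
Record dichotomy_data {R : realType} {d : nat} (A : nat -> 'M[R]_d) (k : nat)
    (sm sp : nat -> R) (P : nat -> nat -> 'M[R]_d) : Prop := DichotomyData {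
  dd_le : (k <= d)%N;
  dd_sp0 : sp k.+1 = 0;
  dd_lt : forall i, (1 <= i <= k)%N -> sp i.+1 < sm i <= sp i;
  dd_spectrum : dichotomy_spectrum A =
    \bigcup_(i in [set i | (1 <= i <= k)%N]) [set` `[sm i, sp i]];
  dd_proj : forall n i, (1 <= i <= k.+1)%N -> P n i *m P n i = P n i;
  dd_inv : forall m n i, (m <= n)%N -> (1 <= i <= k.+1)%N ->
    Phi A n m *m P m i = P n i *m Phi A n m;
  dd_range0 : forall n, mxrange (P n k.+1) = 0%VS;
  dd_range : forall n i, (1 <= i <= k)%N ->
    (mxrange (P n i.+1) <= mxrange (P n i))%VS;
  dd_range1 : forall n, mxrange (P n 1%N) = fullv;
  dd_null0 : forall n, mxnull (P n k.+1) = fullv;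
  dd_null : forall n i, (1 <= i <= k)%N ->
    (mxnull (P n i) <= mxnull (P n i.+1))%VS;
  dd_null1 : forall n, mxnull (P n 1%N) = 0%VS;
  dd_bound : forall i, (1 <= i <= k)%N ->
    forall e : R, 0 < e < sm i - sp i.+1 -> exists K : R,
      forall m n, (m <= n)%N ->
        specnorm (Phi A n m *m P m i.+1) <= K * (sp i.+1 + e) ^+ (n - m) /\
        specnorm (Phi A m n *m (1%:M - P n i.+1)) <= K * (sm i - e) ^- (n - m)
}.

Definition fiber {R : realType} {d : nat} (P : nat -> nat -> 'M[R]_d)
  (n i : nat) : {vspace 'cV[R]_d} :=
  (mxrange (P n i) :&: mxnull (P n i.+1))%VS.

(* The sum of the fibers W_n^a, ..., W_n^b; it is direct for dichotomy data. *)
Definition fiber_sum {R : realType} {d : nat} (P : nat -> nat -> 'M[R]_d)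
  (n a b : nat) : {vspace 'cV[R]_d} :=
  (\sum_(a <= i < b.+1) fiber P n i)%VS.

Definition alpha_disc {R : realType} {d : nat} (A : nat -> 'M[R]_d) (s n : nat)
  (V : {vspace 'cV[R]_d}) : R :=
  n%:R^-1 * \sum_(1 <= k < n.+1)
    max_angle s (mximage (Phi A k.-1 0) V) (mximage (Phi A k 0) V).

Definition I_disc {R : realType} {d : nat} (A : nat -> 'M[R]_d) (s : nat)
  (V : {vspace 'cV[R]_d}) : set R :=
  [set x : R | limn_inf (fun n => alpha_disc A s n V) <= x <=
               limn_sup (fun n => alpha_disc A s n V)].

(* Main.v *)
Require Import Defs.
From mathcomp Require Import all_boot all_order all_algebra.
From mathcomp Require Import all_classical all_reals all_analysis.
From mathcomp Require Import ring lra spectral complex.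

Set Implicit Arguments.
Unset Strict Implicit.
Unset Printing Implicit Defensive.

Import Order.TTheory GRing.Theory Num.Theory.
Import numFieldNormedType.Exports.
Local Open Scope classical_set_scope.
Local Open Scope ring_scope.

(** Write Q_n for the projector P_n^{j+1}.  Because the ranges decrease and
    the null spaces increase with the index, the first j fibers add up to the
    null space N(Q_n) and the remaining ones to the range R(Q_n)
    ([fiber_sum_null], [fiber_sum_range]).

    A vector v of V splits as v = Q_0 v + y with y in N(Q_0).  Under the flow,
    the first part has norm at most K a^n |v|, and y is expanded:
    |y| <= K b^-n |Phi(n,0) y|, where a < b are rates chosen in the spectral
    gap between sigma_{j+1}^+ and sigma_j^-.  Since |y| is the distance
    from v to a point of R(Q_0), it is at least sin(theta_min) |v|.  Hence
    Phi(n,0) v differs from a vector p of N(Q_n) by at most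
    (2 K^2 / theta_min) (a/b)^n |p| ([max_angle_Phi_le]).  A subspace whose
    vectors are that close to those of a second one, of the same dimension,
    makes a maximal angle of the same order with it ([max_angle_le_graph]).
    This is the first estimate, with r = a/b.

    The maximal angle satisfies the triangle inequality and is symmetric
    ([max_angle_triangle], [max_angleC]).  So the k-th summands of the two
    angular averages differ by at most the sum of the angles between the images
    of V and of the fibers at times k-1 and k.  These errors form a geometric
    series, which gives the second estimate.  The averages are bounded and
    their difference tends to 0, so they have the same lower and upper limits
    ([I_disc_eq]).

    The maximal angle is given by the least singular value of VB^T WB for
    orthonormal bases VB, WB.  What is used of it is a variational description
    ([max_angleP]): its cosine is the largest c such that every unit vector of W
    has scalar product at least c with some unit vector of V.  It rests on
    the spectral theorem for real symmetric matrices, deduced from the one for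
    complex Hermitian matrices ([real_spectral]). *)

(** * Scalar product and Euclidean norm *)

Section EuclideanSpace.
Context {R : realType}.

Lemma dotvE d (v w : 'cV[R]_d) : dotv v w = \sum_i v i 0 * w i 0.
Proof. by rewrite /dotv mxE; apply: eq_bigr => i _; rewrite mxE. Qed.

Lemma dotvC d (v w : 'cV[R]_d) : dotv v w = dotv w v.
Proof. by rewrite !dotvE; apply: eq_bigr => i _; rewrite mulrC. Qed.

Lemma dotvDr d (u v w : 'cV[R]_d) : dotv u (v + w) = dotv u v + dotv u w.
Proof. by rewrite /dotv mulmxDr mxE. Qed.

Lemma dotv0r d (u : 'cV[R]_d) : dotv u 0 = 0.
Proof. by rewrite /dotv mulmx0 mxE. Qed.

Lemma dotv0l d (u : 'cV[R]_d) : dotv 0 u = 0.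
Proof. by rewrite dotvC dotv0r. Qed.

Lemma dotvZr d a (u v : 'cV[R]_d) : dotv u (a *: v) = a * dotv u v.
Proof. by rewrite /dotv -scalemxAr mxE. Qed.

Lemma dotvNr d (u v : 'cV[R]_d) : dotv u (- v) = - dotv u v.
Proof. by rewrite /dotv mulmxN mxE. Qed.

Lemma dotvBr d (u v w : 'cV[R]_d) : dotv u (v - w) = dotv u v - dotv u w.
Proof. by rewrite dotvDr dotvNr. Qed.

Lemma dotvDl d (u v w : 'cV[R]_d) : dotv (v + w) u = dotv v u + dotv w u.
Proof. by rewrite dotvC dotvDr !(dotvC u). Qed.

Lemma dotvZl d a (u v : 'cV[R]_d) : dotv (a *: v) u = a * dotv v u.
Proof. by rewrite dotvC dotvZr (dotvC u). Qed.

Lemma dotvNl d (u v : 'cV[R]_d) : dotv (- v) u = - dotv v u.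
Proof. by rewrite dotvC dotvNr (dotvC u). Qed.

Lemma dotvBl d (u v w : 'cV[R]_d) : dotv (v - w) u = dotv v u - dotv w u.
Proof. by rewrite dotvDl dotvNl. Qed.

Lemma dotv_mulmxl d p (M : 'M[R]_(d, p)) x y :
  dotv (M *m x) y = dotv x (M^T *m y).
Proof. by rewrite /dotv trmx_mul mulmxA. Qed.

Lemma dotvv_ge0 d (v : 'cV[R]_d) : 0 <= dotv v v.
Proof. by rewrite dotvE sumr_ge0 // => i _; rewrite -expr2 sqr_ge0. Qed.

Lemma dotvv_eq0 d (v : 'cV[R]_d) : (dotv v v == 0) = (v == 0).
Proof.
apply/eqP/eqP => [|->]; last exact: dotv0r.
rewrite dotvE => /eqP; rewrite psumr_eq0 => [/allP v0|i _]; last first.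
  by rewrite -expr2 sqr_ge0.
apply/colP => i; rewrite mxE; apply/eqP.
by have := v0 i (mem_index_enum i); rewrite mulf_eq0 orbb.
Qed.

Lemma sqr_norm2 d (v : 'cV[R]_d) : norm2 v ^+ 2 = dotv v v.
Proof. by rewrite sqr_sqrtr // dotvv_ge0. Qed.

Lemma norm2_ge0 d (v : 'cV[R]_d) : 0 <= norm2 v.
Proof. exact: sqrtr_ge0. Qed.

Lemma norm2_eq0 d (v : 'cV[R]_d) : (norm2 v == 0) = (v == 0).
Proof. by rewrite -dotvv_eq0 -sqr_norm2 expf_eq0. Qed.

Lemma norm2_0 d : norm2 (0 : 'cV[R]_d) = 0.
Proof. by apply/eqP; rewrite norm2_eq0. Qed.

Lemma norm2_gt0 d (v : 'cV[R]_d) : (0 < norm2 v) = (v != 0).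
Proof. by rewrite lt_def norm2_ge0 norm2_eq0 andbT. Qed.

Lemma norm2Z d a (v : 'cV[R]_d) : norm2 (a *: v) = `|a| * norm2 v.
Proof.
by rewrite /norm2 dotvZl dotvZr mulrA -expr2 sqrtrM ?sqr_ge0 // sqrtr_sqr.
Qed.

Lemma norm2_normalize d (v : 'cV[R]_d) : v != 0 ->
  norm2 ((norm2 v)^-1 *: v) = 1.
Proof.
move=> v0; rewrite norm2Z ger0_norm ?invr_ge0 ?norm2_ge0 //.
by rewrite mulVf // norm2_eq0.
Qed.

(** Expand | |w| v - |v| w |^2 >= 0. *)
Lemma dotv_le d (v w : 'cV[R]_d) : dotv v w <= norm2 v * norm2 w.
Proof.
have [->|v0] := eqVneq v 0.
  by rewrite dotv0l mulr_ge0 ?norm2_ge0.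
have [->|w0] := eqVneq w 0.
  by rewrite dotv0r mulr_ge0 ?norm2_ge0.
have := dotvv_ge0 (norm2 w *: v - norm2 v *: w).
rewrite !(dotvBl, dotvBr, dotvZl, dotvZr) (dotvC w v) -!sqr_norm2.
have nv : 0 < norm2 v by rewrite norm2_gt0.
have nw : 0 < norm2 w by rewrite norm2_gt0.
move: (norm2 v) (norm2 w) (dotv v w) nv nw => a b c a0 b0.
rewrite (_ : _ - _ = 2 * (a * b) * (a * b - c)); last by ring.
by rewrite pmulr_rge0 ?subr_ge0 // mulr_gt0 ?mulr_gt0.
Qed.

Lemma norm_dotv_le d (v w : 'cV[R]_d) : `|dotv v w| <= norm2 v * norm2 w.
Proof.
rewrite ler_norml dotv_le andbT lerNl -dotvNr.
by rewrite (le_trans (dotv_le _ _)) // -scaleN1r norm2Z normrN1 mul1r.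
Qed.

Lemma norm2_isometry d p (B : 'M[R]_(d, p)) x :
  B^T *m B = 1%:M -> norm2 (B *m x) = norm2 x.
Proof.
by move=> BB; rewrite /norm2 dotv_mulmxl mulmxA BB mul1mx.
Qed.

(** Cauchy-Schwarz row by row: the constant is the Frobenius norm.  It shows
    that the supremum defining [specnorm] is taken over a bounded set. *)
Lemma norm2_mulmx_bounded d p (M : 'M[R]_(d, p)) :
  exists2 c : R, 0 <= c & forall x, norm2 (M *m x) <= c * norm2 x.
Proof.
exists (Num.sqrt (\sum_i norm2 (row i M)^T ^+ 2)); first exact: sqrtr_ge0.
move=> x; rewrite {1 3}/norm2 -sqrtrM; last first.
  by rewrite sumr_ge0 // => i _; exact: sqr_ge0.
rewrite ler_sqrt; last first.
  by rewrite mulr_ge0 ?dotvv_ge0 // sumr_ge0 // => i _; exact: sqr_ge0.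
rewrite dotvE mulr_suml; apply: ler_sum => i _.
have -> : (M *m x) i 0 = dotv (row i M)^T x.
  by rewrite /dotv trmxK -row_mul [RHS]mxE.
rewrite -expr2 -sqr_norm2 -exprMn -[leLHS]real_normK ?num_real //.
by rewrite lerXn2r ?nnegrE ?mulr_ge0 ?norm2_ge0 ?norm_dotv_le.
Qed.

Lemma norm2_mulmx_le d (M : 'M[R]_d) x :
  norm2 (M *m x) <= specnorm M * norm2 x.
Proof.
have [->|x0] := eqVneq x 0.
  by rewrite mulmx0 norm2_0 mulr0.
have nx : 0 < norm2 x by rewrite norm2_gt0.
have [c c0 Mc] := norm2_mulmx_bounded M.
have : norm2 (M *m ((norm2 x)^-1 *: x)) <= specnorm M.
  apply: ub_le_sup; last first.
    by exists ((norm2 x)^-1 *: x) => //=; rewrite norm2_normalize.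
  exists c => _ [y /= y1 <-]; apply: le_trans (Mc y) _.
  by rewrite ler_piMr.
by rewrite -scalemxAr norm2Z gtr0_norm ?invr_gt0 // mulrC ler_pdivrMr.
Qed.

End EuclideanSpace.

(** * Subspaces and orthonormal bases *)

Section MatrixSubspaces.
Context {R : realType}.

Lemma memv_mxrangeP d p (M : 'M[R]_(d, p)) x :
  reflect (exists y, x = M *m y) (x \in mxrange M).
Proof.
apply: (iffP memv_imgP) => [[y _ ->]|[y ->]]; first by exists y; rewrite lfunE.
by exists y; rewrite ?memvf // lfunE.
Qed.

Lemma memv_mxnull d p (M : 'M[R]_(d, p)) x :
  (x \in mxnull M) = (M *m x == 0).
Proof. by rewrite memv_ker lfunE. Qed.

Lemma memv_mximageP d p (M : 'M[R]_(d, p)) (V : {vspace 'cV[R]_p}) x :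
  reflect (exists2 y, y \in V & x = M *m y) (x \in mximage M V).
Proof.
apply: (iffP memv_imgP) => [[y yV ->]|[y yV ->]]; exists y => //;
  by rewrite lfunE.
Qed.

Lemma exists_unit_vector d (V : {vspace 'cV[R]_d}) : (0 < \dim V)%N ->
  exists2 v, v \in V & norm2 v = 1.
Proof.
rewrite lt0n dimv_eq0 -vpick0 => v0.
exists ((norm2 (vpick V))^-1 *: vpick V); first by rewrite memvZ ?memv_pick.
exact: norm2_normalize.
Qed.

(** Induction on the dimension: a unit vector e of V, completed by a basis of
    the orthogonal complement of e in V, which is the kernel of e^T on V. *)
Lemma exists_onbasis d s (V : {vspace 'cV[R]_d}) : \dim V = s ->
  exists B : 'M[R]_(d, s), is_onbasis V B.
Proof.
elim: s V => [|s IHs] V dV.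
  exists 0; split; first by rewrite [LHS]flatmx0 [RHS]flatmx0.
  move/eqP: dV; rewrite dimv_eq0 => /eqP->; apply/eqP; rewrite -subv0.
  by apply/subvP => _ /memv_mxrangeP[y ->]; rewrite mul0mx mem0v.
have [|e eV e1] := @exists_unit_vector _ V; first by rewrite dV.
have ee : dotv e e = 1 by rewrite -sqr_norm2 e1 expr1n.
have eTe : e^T *m e = 1%:M by apply/matrixP => i j; rewrite !ord1 [LHS]ee mxE.
have [|B [BB BV]] := IHs (V :&: mxnull e^T)%VS.
  have := limg_ker_dim (mxlin e^T) V; rewrite dV.
  have -> : (mxlin e^T @: V)%VS = fullv.
    apply/eqP; rewrite eqEsubv subvf /=; apply/subvP => x _.
    apply/memv_imgP; exists (e *m x).
      by rewrite (mx11_scalar x) mul_mx_scalar memvZ.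
    by rewrite lfunE /= mulmxA eTe mul1mx.
  by rewrite dimvf /dim /= muln1 addn1 => -[].
have eB : e^T *m B = 0.
  apply/matrixP => i j; rewrite !ord1.
  have : col j B \in mxrange B.
    by apply/memv_mxrangeP; exists (delta_mx j 0); rewrite colE.
  rewrite BV memv_cap memv_mxnull => /andP[_ /eqP/matrixP/(_ 0 0)].
  by rewrite colE mulmxA -colE !mxE.
suff : @is_onbasis _ _ (1 + s) V (row_mx e B) by exists (row_mx e B).
split.
  rewrite tr_row_mx mul_col_row eTe BB eB -[X in block_mx _ _ X _]trmxK.
  by rewrite trmx_mul trmxK eB trmx0 -scalar_mx_block.
apply/vspaceP => x; apply/memv_mxrangeP/idP => [[y ->]|xV].
  rewrite -[y]vsubmxK mul_row_col memvD //.
    by rewrite [usubmx y]mx11_scalar mul_mx_scalar memvZ.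
  have : B *m dsubmx y \in mxrange B by apply/memv_mxrangeP; exists (dsubmx y).
  by rewrite BV memv_cap => /andP[].
have : x - e *m (e^T *m x) \in mxrange B.
  rewrite BV memv_cap memvB //=.
    by rewrite memv_mxnull mulmxBr (mulmxA e^T) eTe mul1mx subrr.
  by rewrite [e^T *m x]mx11_scalar mul_mx_scalar memvZ.
case/memv_mxrangeP => y xy; exists (col_mx (e^T *m x) y).
by rewrite mul_row_col -xy addrC subrK.
Qed.

End MatrixSubspaces.

(** * Singular values of real matrices *)

Section SingularValues.
Local Open Scope sesquilinear_scope.

Lemma char_poly_similar (F : fieldType) n (U D : 'M[F]_n) : U \in unitmx ->
  char_poly (invmx U *m D *m U) = char_poly D.
Proof.
move=> Uu; rewrite /char_poly /char_poly_mx !map_mxM /=.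
have UU : map_mx polyC (invmx U) *m map_mx polyC U = 1%:M.
  by rewrite -map_mxM mulVmx // map_mx1.
have XE : ('X%:M : 'M[{poly F}]_n) =
    map_mx polyC (invmx U) *m 'X%:M *m map_mx polyC U.
  by rewrite scalar_mxC -mulmxA UU mulmx1.
rewrite [in LHS]XE -mulmxBl -mulmxBr !det_mulmx mulrAC -det_mulmx.
by rewrite UU det1 mul1r.
Qed.

Context {R : realType}.

Local Notation C := (complex.complex R).
Local Notation toC := (complex.real_complex R).

(** The spectral theorem without its orthogonal matrix, which would have to be
    made real.  Diagonalize S over the complex numbers by a unitary U: its
    eigenvalues are real, and for a real x the numbers y i = |(U x)_i|^2 are the
    weights with which x^T S x averages the eigenvalues. *)
Lemma real_spectral n (S : 'M[R]_n) : S^T = S ->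
  exists D : 'rV[R]_n,
    char_poly S = \prod_i ('X - (D 0 i)%:P) /\
    forall x : 'cV[R]_n, exists y : 'I_n -> R,
      [/\ forall i, 0 <= y i, \sum_i y i = dotv x x &
          dotv x (S *m x) = \sum_i D 0 i * y i].
Proof.
move=> ST; pose Sc := map_mx toC S.
have Sreal : Sc \is a mxOver Num.real.
  by apply/mxOverP => i j; rewrite mxE; apply/complex.complex_realP; eexists.
have Ssym : Sc \is symmetricmx.
  apply/is_hermitianmxP; rewrite expr0 scale1r map_mx_id // /Sc.
by rewrite map_trmx ST.
have Sherm := realsym_hermsym Ssym Sreal.
have /orthomx_spectralP Sdec := hermitian_normalmx Sherm.
have /mxOverP Dreal := hermitian_spectral_diag_real Sherm.
set U := spectralmx Sc in Sdec; set Dc := spectral_diag Sc in Sdec Dreal.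
have Uunit : U \in unitmx by exact: spectral_unit.
have Uuni : U \is unitarymx by exact: spectral_unitarymx.
pose D := map_mx (@complex.Re R) Dc.
have DE i : Dc 0 i = toC (D 0 i).
  by rewrite mxE complex.RRe_real // Dreal.
exists D; split.
  apply: (map_poly_inj toC); rewrite map_char_poly -/Sc Sdec.
  rewrite char_poly_similar // char_poly_trig ?diag_mx_is_trig //.
  rewrite rmorph_prod; apply: eq_bigr => i _.
  by rewrite rmorphB /= map_polyX map_polyC /= mxE eqxx mulr1n DE.
move=> x; pose z := U *m map_mx toC x.
have UU : U^t* *m U = 1%:M.
  by rewrite -invmx_unitary // mulVmx.
have toCdot (u v : 'cV[R]_n) :
    toC (dotv u v) = ((map_mx toC u)^T *m map_mx toC v) 0 0.
  by rewrite map_trmx -map_mxM [RHS]mxE.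
have conjx : (map_mx toC x)^T = (map_mx toC x)^t*.
  by apply/matrixP => i j; rewrite !mxE; exact/esym/complex.conjc_real.
have zt : z^t* = (map_mx toC x)^t* *m U^t*.
  by rewrite /z trmx_mul map_mxM.
exists (fun i => complex.Re (`|z i 0| ^+ 2)).
have yE i : toC (complex.Re (`|z i 0| ^+ 2)) = (z i 0)^* * z i 0.
  rewrite complex.RRe_real ?realX ?normr_real //.
  by rewrite normCK mulrC.
split.
- by move=> i; rewrite -complex.ler0c yE mulrC mul_conjC_ge0.
- apply: (@complex.complexI R); rewrite rmorph_sum toCdot /=.
  transitivity ((z^t* *m z) 0 0).
    by rewrite mxE; apply: eq_bigr => i _; rewrite yE !mxE.
  by rewrite zt /z mulmxA -(mulmxA _ _ U) UU mulmx1 -conjx.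
- apply: (@complex.complexI R); rewrite toCdot rmorph_sum /=.
  transitivity ((z^t* *m diag_mx Dc *m z) 0 0).
    have -> : map_mx toC (S *m x) = Sc *m map_mx toC x by exact: map_mxM.
    have -> : Sc *m map_mx toC x = U^t* *m (diag_mx Dc *m z).
      rewrite /z (mulmxA (diag_mx Dc)) mulmxA; congr (_ *m _).
      by rewrite mulmxA -(invmx_unitary Uuni) -Sdec.
    by rewrite conjx mulmxA -zt mulmxA.
  rewrite mxE; apply: eq_bigr => i _.
  have -> : (z^t* *m diag_mx Dc) 0 i = (z i 0)^* * Dc 0 i.
    by rewrite mul_mx_diag !mxE.
  by rewrite [RHS](rmorphM toC) /= yE -DE mulrAC mulrC.
Qed.

Lemma gram_dotv d p (M : 'M[R]_(d, p)) x :
  dotv x (M^T *m M *m x) = norm2 (M *m x) ^+ 2.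
Proof. by rewrite sqr_norm2 dotv_mulmxl mulmxA. Qed.

(** A unit eigenvector x satisfies |M x|^2 = <x, M^T M x> = a. *)
Lemma gram_eigenvector d p (M : 'M[R]_(d, p)) a :
  root (char_poly (M^T *m M)) a ->
  exists2 x, norm2 x = 1 & norm2 (M *m x) ^+ 2 = a.
Proof.
rewrite -eigenvalue_root_char => /eigenvalueP[v va v0].
have w0 : v^T != 0 by rewrite -trmx0 (inj_eq (can_inj trmxK)).
pose x := (norm2 v^T)^-1 *: v^T.
have x1 : norm2 x = 1 by exact: norm2_normalize.
exists x => //; rewrite -gram_dotv.
have -> : M^T *m M *m x = a *: x.
  have gramT : (M^T *m M)^T = M^T *m M by rewrite trmx_mul trmxK.
  by rewrite -scalemxAr -gramT -trmx_mul va linearZ /= scalerA mulrC -scalerA.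
by rewrite dotvZr -sqr_norm2 x1 expr1n mulr1.
Qed.

Lemma exists_singular_values n (M : 'M[R]_n) :
  exists sv, is_singular_values M sv.
Proof.
have [|D [cD _]] := @real_spectral n (M^T *m M).
  by rewrite trmx_mul trmxK.
have D0 i : 0 <= D 0 i.
  have [|x _ <-] := @gram_eigenvector _ _ M (D 0 i); last exact: sqr_ge0.
  rewrite cD -(big_map (fun i => D 0 i) xpredT (fun a => 'X - a%:P)).
  by rewrite root_prod_XsubC map_f // mem_index_enum.
pose t := [seq Num.sqrt (D 0 i) | i <- index_enum 'I_n].
have pt : perm_eq (sort >=%R t) t by rewrite perm_sort.
exists (sort >=%R t); split.
- by rewrite size_sort size_map /index_enum unlock -enumT size_enum_ord.
- by apply: sort_sorted => x y; exact: ge_total.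
- by rewrite all_sort; apply/allP => _ /mapP[i _ ->]; exact: sqrtr_ge0.
- rewrite cD (perm_big _ pt) big_map; apply: eq_bigr => i _.
  by rewrite sqr_sqrtr.
Qed.

(** The square of the least singular value is the least eigenvalue of M^T M,
    hence the minimum of the Rayleigh quotient |M x|^2 / |x|^2. *)
Lemma least_singular_value s (M : 'M[R]_s) sv : (0 < s)%N ->
  is_singular_values M sv ->
  [/\ 0 <= nth 0 sv s.-1,
      forall x, nth 0 sv s.-1 * norm2 x <= norm2 (M *m x) &
      exists2 x, norm2 x = 1 & norm2 (M *m x) = nth 0 sv s.-1].
Proof.
move=> s0 [sz so sv0 csv]; set c := nth 0 sv s.-1.
have csvE : c \in sv by rewrite mem_nth // sz prednK.
have c0 : 0 <= c by exact: (allP sv0).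
have cmin a : a \in sv -> c <= a.
  move=> /(nthP 0)[i + <-]; rewrite sz => ilt.
  have := @sorted_leq_nth _ (>=%R : rel R) ge_trans ge_refl 0 sv so i s.-1.
  by rewrite /= !inE sz ilt prednK // => -> //; rewrite -ltnS prednK.
have rootsv a : root (char_poly (M^T *m M)) a = (a \in [seq x ^+ 2 | x <- sv]).
  rewrite csv -(big_map (fun x => x ^+ 2) xpredT (fun a => 'X - a%:P)).
  by rewrite root_prod_XsubC.
split=> // [x|].
  have [|D [cD /(_ x)[y [y0 sy Sy]]]] := @real_spectral s (M^T *m M).
    by rewrite trmx_mul trmxK.
  have Dc i : c ^+ 2 <= D 0 i.
    have : root (char_poly (M^T *m M)) (D 0 i).
      rewrite cD -(big_map (fun i => D 0 i) xpredT (fun a => 'X - a%:P)).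
      by rewrite root_prod_XsubC map_f // mem_index_enum.
    rewrite rootsv => /mapP[a asv ->].
    by rewrite lerXn2r ?nnegrE ?cmin ?(allP sv0).
  rewrite -(@ler_pXn2r _ 2) ?nnegrE ?mulr_ge0 ?norm2_ge0 //.
  rewrite exprMn -gram_dotv Sy sqr_norm2 -sy mulr_sumr.
  by apply: ler_sum => i _; rewrite ler_wpM2r.
have [|x x1 Mx] := @gram_eigenvector _ _ M (c ^+ 2).
  by rewrite rootsv; apply/mapP; exists c.
exists x => //; apply/eqP.
by rewrite -(@eqrXn2 _ 2) ?norm2_ge0 // Mx.
Qed.

End SingularValues.

(** * Inequalities for the arccosine and the sine *)

Section Arccosine.
Context {R : realType}.

Lemma ler_acos (x y : R) : -1 <= x -> x <= y -> y <= 1 -> acos y <= acos x.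
Proof.
move=> x1 xy y1.
have ax : -1 <= x <= 1 by rewrite x1 (le_trans xy).
have ay : -1 <= y <= 1 by rewrite y1 (le_trans x1).
rewrite leNgt; apply/negP => lt_ax.
have : cos (acos y) < cos (acos x).
  by rewrite ltr_cos ?in_itv /= ?acos_ge0 ?acos_lepi.
by rewrite !acosK ?in_itv //= ltNge xy.
Qed.

Lemma acos_lepi2 (x : R) : 0 <= x <= 1 -> acos x <= pi / 2.
Proof. by case/andP=> x0 x1; rewrite -acos0 ler_acos // lerN10. Qed.

Lemma cos_le_mono (x y : R) : 0 <= x -> x <= y -> y <= pi -> cos y <= cos x.
Proof.
move=> x0 xy ypi; rewrite leNgt; apply/negP.
rewrite ltr_cos ?in_itv /= ?x0 ?(le_trans xy) ?(le_trans x0) //.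
by rewrite ltNge xy.
Qed.

(** The left-hand side of the hypothesis is cos (acos x + acos y). *)
Lemma acos_le_add (x y z : R) : -1 <= x <= 1 -> -1 <= y <= 1 -> -1 <= z <= 1 ->
  x * y - Num.sqrt (1 - x ^+ 2) * Num.sqrt (1 - y ^+ 2) <= z ->
  acos z <= acos x + acos y.
Proof.
move=> x1 y1 z1 xyz.
have [big|small] := leP pi (acos x + acos y).
  by rewrite (le_trans _ big) // acos_lepi.
have s0 : 0 <= acos x + acos y by rewrite addr_ge0 // acos_ge0.
rewrite -[leRHS](cosK (x := acos x + acos y)) ?in_itv /= ?s0 ?(ltW small) //.
rewrite ler_acos ?cos_geN1 //; last by case/andP: z1.
by rewrite cosD !sin_acos // !acosK ?in_itv.
Qed.

Lemma pi_le4 : (pi : R) <= 4.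
Proof.
have [/andP[_]] := @pihalf_02_cos_pihalf R.
by rewrite ler_pdivrMr // -natrM.
Qed.

(** From sin t = 2 sin (t / 2) cos (t / 2), where the mean value theorem gives
    sin (t / 2) >= (t / 2) cos (t / 2), and 2 cos (t / 2)^2 = 1 + cos t >= 1. *)
Lemma le_2sin (t : R) : 0 <= t <= pi / 2 -> t <= 2 * sin t.
Proof.
case/andP=> t0 tpi; set h := t / 2.
have h0 : 0 <= h by rewrite divr_ge0.
have pi0 := @pi_ge0 R.
have hpi : h <= pi / 2 by rewrite /h; lra.
have sin_within : {within `[0, h], continuous (@sin R)}.
  by apply/continuous_subspaceT; exact: continuous_sin.
have [c] := MVT_segment h0 (fun x _ => is_derive_sin x) sin_within.
rewrite in_itv /= sin0 !subr0 => /andP[c0 ch] sinh.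
have cosh0 : 0 <= cos h by rewrite cos_ge0_pihalf // hpi andbT; lra.
have cosch : cos h <= cos c by rewrite cos_le_mono //; lra.
have ht : t = h *+ 2 by rewrite /h mulr2n; lra.
have cost : 0 <= cos t by rewrite cos_ge0_pihalf // tpi andbT; lra.
move: cost; rewrite ht cos_mulr2n sin_mulr2n sinh !mulr2n => cost.
have h1 : 0 <= h * cos h * (cos c - cos h) by rewrite !mulr_ge0 ?subr_ge0.
have h2 := mulr_ge0 h0 cost.
by clear -h1 h2; nra.
Qed.

End Arccosine.

(** * Maximal and minimal principal angles *)

Section PrincipalAngles.
Context {R : realType} {d : nat}.
Implicit Types (V W U : {vspace 'cV[R]_d}) (u v w : 'cV[R]_d).

Lemma mulmx_inj_left_inverse p q (B : 'M[R]_(p, q)) :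
  (forall x : 'cV[R]_q, B *m x = 0 -> x = 0) ->
  exists L : 'M[R]_(q, p), L *m B = 1%:M.
Proof.
move=> Binj; suff : row_free B^T.
  move=> /mulmxVp/(congr1 trmx); rewrite trmx_mul trmxK trmx1 => LB.
  by exists (pinvmx B^T)^T.
rewrite -kermx_eq0; apply/eqP/row_matrixP => i; rewrite row0.
apply: (can_inj trmxK); rewrite trmx0; apply: Binj.
by rewrite -{1}[B]trmxK -trmx_mul -row_mul mulmx_ker row0 trmx0.
Qed.

Lemma norm_dotv_le1 u v : norm2 u = 1 -> norm2 v = 1 -> -1 <= dotv u v <= 1.
Proof.
by move=> u1 v1; have := norm_dotv_le u v; rewrite u1 v1 mul1r ler_norml.
Qed.

(** Cauchy-Schwarz for the components of u and w orthogonal to v, of squared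
    norms 1 - <u,v>^2 and 1 - <v,w>^2 and scalar product
    <u,w> - <u,v> <v,w>. *)
Lemma sphere_triangle u v w : norm2 u = 1 -> norm2 v = 1 -> norm2 w = 1 ->
  acos (dotv u w) <= acos (dotv u v) + acos (dotv v w).
Proof.
move=> u1 v1 w1; apply: acos_le_add; rewrite ?norm_dotv_le1 //.
have unit (x : 'cV[R]_d) : norm2 x = 1 -> dotv x x = 1.
  by move=> x1; rewrite -sqr_norm2 x1 expr1n.
have := norm_dotv_le (u - dotv u v *: v) (w - dotv v w *: v).
rewrite /norm2 !(dotvBl, dotvBr, dotvZl, dotvZr) !(unit u, unit v, unit w) //.
rewrite (dotvC v u) (dotvC w v).
move: (dotv u v) (dotv v w) (dotv u w) => x y z.
rewrite (_ : _ - _ = z - x * y); last by ring.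
rewrite (_ : 1 - _ - _ = 1 - x ^+ 2); last by ring.
rewrite (_ : 1 - _ - _ = 1 - y ^+ 2); last by ring.
by rewrite ler_norml => /andP[+ _]; rewrite lerNl opprB lerBlDr -lerBlDl.
Qed.

(** The angle from any vector of W to V is at most acos c.  For subspaces of
    different dimensions this would be an asymmetric relation. *)
Definition within_cosine (c : R) V W := forall w, w \in W -> norm2 w = 1 ->
  exists v, [/\ v \in V, norm2 v = 1 & c <= dotv w v].

Lemma memv_onbasisP s V (B : 'M[R]_(d, s)) : is_onbasis V B ->
  forall v, reflect (exists2 x, v = B *m x & norm2 x = norm2 v) (v \in V).
Proof.
case=> BB <- v; apply: (iffP (memv_mxrangeP _ _)) => [[x ->]|[x -> _]].
  by exists x; rewrite ?norm2_isometry.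
by exists x.
Qed.

(** The unit vector of V with the largest scalar product with w = WB x points
    along the orthogonal projection of w, of norm |VB^T WB x|. *)
Lemma within_cosine_onbasis s c V W (VB WB : 'M[R]_(d, s)) :
  (0 < s)%N -> 0 <= c -> is_onbasis V VB -> is_onbasis W WB ->
  (within_cosine c V W <->
   forall x, c * norm2 x <= norm2 (VB^T *m WB *m x)).
Proof.
move=> s0 c0 bV bW; have PV := memv_onbasisP bV; have PW := memv_onbasisP bW.
have dotB x y : dotv (WB *m x) (VB *m y) = dotv (VB^T *m WB *m x) y.
  by rewrite dotvC dotv_mulmxl mulmxA dotvC.
have isoV y : norm2 (VB *m y) = norm2 y by apply: norm2_isometry; case: bV.
have isoW y : norm2 (WB *m y) = norm2 y by apply: norm2_isometry; case: bW.
have inV y : VB *m y \in V by apply/PV; exists y; rewrite ?isoV.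
have inW y : WB *m y \in W by apply/PW; exists y; rewrite ?isoW.
split=> [cVW x|cM _ /PW[x -> xw] x1].
  have [->|x0] := eqVneq x 0.
    by rewrite norm2_0 mulr0 norm2_ge0.
  have nx : 0 < norm2 x by rewrite norm2_gt0.
  have [||_ [/PV[y -> _] y1]] := cVW (WB *m ((norm2 x)^-1 *: x)).
  - exact: inW.
  - by rewrite isoW norm2_normalize.
  rewrite dotB -scalemxAr dotvZl mulrC ler_pdivlMr // => /le_trans; apply.
  by apply: le_trans (dotv_le _ _) _; rewrite -(isoV y) y1 mulr1.
rewrite isoW in x1; set z := VB^T *m WB *m x.
have cz : c <= norm2 z by have := cM x; rewrite x1 mulr1.
(* When w is orthogonal to V, c is 0 and any unit vector of V will do. *)
have [z0|z0] := eqVneq z 0.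
  pose y : 'cV[R]_s := delta_mx (Ordinal s0) 0.
  have y0 : y != 0.
    by apply/eqP => /colP/(_ (Ordinal s0))/eqP; rewrite !mxE !eqxx oner_eq0.
  exists (VB *m ((norm2 y)^-1 *: y)); split; rewrite ?isoV ?norm2_normalize //.
  by rewrite dotB -/z z0 dotv0l; move: cz; rewrite z0 norm2_0.
exists (VB *m ((norm2 z)^-1 *: z)); split; rewrite ?isoV ?norm2_normalize //.
by rewrite dotB -/z dotvZr -sqr_norm2 expr2 mulKf ?norm2_eq0.
Qed.

(** With X = M^-1, |y|^2 = <M^T y, X y> <= |M^T y| |X y| <= |M^T y| |y| / c. *)
Lemma norm2_lower_bound_tr s c (M : 'M[R]_s) : 0 <= c ->
  (forall x, c * norm2 x <= norm2 (M *m x)) ->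
  forall y, c * norm2 y <= norm2 (M^T *m y).
Proof.
rewrite le_eqVlt => /predU1P[<- _ y|c0 cM y]; first by rewrite mul0r norm2_ge0.
have [x Mx0|X XM] := @mulmx_inj_left_inverse _ _ M.
  apply/eqP; rewrite -norm2_eq0 eq_le norm2_ge0 andbT -(ler_pM2l c0).
  by rewrite mulr0 (le_trans (cM x)) // Mx0 norm2_0.
have [->|y0] := eqVneq y 0.
  by rewrite norm2_0 mulr0 norm2_ge0.
have ny : 0 < norm2 y by rewrite norm2_gt0.
have yX : M *m (X *m y) = y by rewrite mulmxA (mulmx1C XM) mul1mx.
rewrite -(ler_pM2r ny) -mulrA -expr2 sqr_norm2 -{1}yX dotv_mulmxl dotvC.
apply: le_trans (ler_wpM2l (ltW c0) (dotv_le _ _)) _.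
rewrite mulrCA ler_wpM2l ?norm2_ge0 //.
by apply: le_trans (cM _) _; rewrite yX.
Qed.

Lemma within_cosine_sym s c V W : (0 < s)%N -> 0 <= c ->
  \dim V = s -> \dim W = s -> within_cosine c V W -> within_cosine c W V.
Proof.
move=> s0 c0 /exists_onbasis[VB bV] /exists_onbasis[WB bW].
rewrite (within_cosine_onbasis s0 c0 bV bW) (within_cosine_onbasis s0 c0 bW bV).
by move/(norm2_lower_bound_tr c0) => + y => /(_ y); rewrite trmx_mul trmxK.
Qed.

(** The last two clauses characterize c as a minimum over W of maxima over V of
    scalar products; maximal angles are compared through this description. *)
Lemma max_angleP s V W : (0 < s)%N -> \dim V = s -> \dim W = s ->
  exists c, [/\ 0 <= c <= 1, max_angle s V W = acos c, within_cosine c V W &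
    exists w, [/\ w \in W, norm2 w = 1 &
      forall v, v \in V -> norm2 v = 1 -> dotv w v <= c]].
Proof.
move=> s0 dV dW.
have [VB0 bV0] := exists_onbasis dV; have [WB0 bW0] := exists_onbasis dW.
have [sv0 svM0] := exists_singular_values (VB0^T *m WB0).
rewrite /max_angle.
case: xgetP => [t -> [VB [WB [sv [bV bW svM ->]]]]|]; last first.
  by move=> /(_ (acos (nth 0 sv0 s.-1))); case; exists VB0, WB0, sv0.
have [c0 cM [x x1 Mx]] := least_singular_value s0 svM.
set c := nth 0 sv s.-1 in c0 cM Mx *.
have cVW : within_cosine c V W by apply/(within_cosine_onbasis s0 c0 bV bW).
exists c; split=> //.
  rewrite c0; have [w wW w1] : exists2 w, w \in W & norm2 w = 1.
    by apply: exists_unit_vector; rewrite dW.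
  have [v [_ v1]] := cVW w wW w1; move/le_trans; apply.
  by have /andP[] := norm_dotv_le1 w1 v1.
have PV := memv_onbasisP bV; have PW := memv_onbasisP bW.
exists (WB *m x); split.
- by apply/PW; exists x => //; rewrite norm2_isometry //; case: bW.
- by rewrite norm2_isometry //; case: bW.
- move=> _ /PV[y -> yv] v1; rewrite dotvC dotv_mulmxl dotvC mulmxA.
  by apply: le_trans (dotv_le _ _) _; rewrite Mx yv v1 mulr1.
Qed.

Lemma max_angle_ge0 s V W : (0 < s)%N -> \dim V = s -> \dim W = s ->
  0 <= max_angle s V W.
Proof.
move=> s0 dV dW; have [c [/andP[c0 c1] -> _ _]] := max_angleP s0 dV dW.
by rewrite acos_ge0 // c1 andbT (le_trans _ c0) // lerN10.
Qed.

Lemma max_angle_lepi2 s V W : (0 < s)%N -> \dim V = s -> \dim W = s ->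
  max_angle s V W <= pi / 2.
Proof.
by move=> s0 dV dW; have [c [c01 -> _ _]] := max_angleP s0 dV dW;
  exact: acos_lepi2.
Qed.

Lemma max_angle_le_acos s c V W : (0 < s)%N -> \dim V = s -> \dim W = s ->
  0 <= c -> within_cosine c V W -> max_angle s V W <= acos c.
Proof.
move=> s0 dV dW c0 cVW; have [b [/andP[b0 b1] -> _]] := max_angleP s0 dV dW.
case=> w [wW w1 wb]; have [v [vV v1 cv]] := cVW w wW w1.
rewrite ler_acos // ?(le_trans cv (wb v vV v1)) //.
by rewrite (le_trans _ c0) // lerN10.
Qed.

Lemma max_angleC s V W : (0 < s)%N -> \dim V = s -> \dim W = s ->
  max_angle s V W = max_angle s W V.
Proof.
move=> s0 dV dW.
have le V' W' : \dim V' = s -> \dim W' = s ->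
    max_angle s V' W' <= max_angle s W' V'.
  move=> dV' dW'; have [c [/andP[c0 _] -> cWV _]] := max_angleP s0 dW' dV'.
  exact/max_angle_le_acos/(within_cosine_sym s0).
by apply/eqP; rewrite eq_le !le.
Qed.

(** Start from a worst vector w of W, go to a nearby u in U, then to a nearby v
    in V, and use the triangle inequality on the sphere. *)
Lemma max_angle_triangle s V U W : (0 < s)%N ->
  \dim V = s -> \dim U = s -> \dim W = s ->
  max_angle s V W <= max_angle s V U + max_angle s U W.
Proof.
move=> s0 dV dU dW.
have [a [/andP[a0 a1] -> _ [w [wW w1 wa]]]] := max_angleP s0 dV dW.
have [b [/andP[b0 b1] -> bVU _]] := max_angleP s0 dV dU.
have [c [/andP[c0 c1] -> cUW _]] := max_angleP s0 dU dW.
have [u [uU u1 cu]] := cUW w wW w1; have [v [vV v1 bv]] := bVU u uU u1.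
have geN1 x : 0 <= x -> -1 <= x :> R by apply: le_trans; rewrite lerN10.
have /andP[wv1 _] := norm_dotv_le1 w1 v1.
apply: le_trans (ler_acos wv1 (wa v vV v1) a1) _.
apply: le_trans (sphere_triangle w1 u1 v1) _; rewrite addrC.
have /andP[_ wu1] := norm_dotv_le1 w1 u1.
have /andP[_ uv1] := norm_dotv_le1 u1 v1.
by rewrite lerD // ler_acos // geN1.
Qed.

(** If |v - w| <= e |w| then the sine of the angle between v and w is at most e,
    and t <= 2 sin t turns this into a bound on the angle.  For e > 1 the
    trivial bound pi / 2 <= 2 suffices. *)
Lemma max_angle_le_graph s (e : R) V W : (0 < s)%N ->
  \dim V = s -> \dim W = s -> 0 <= e ->
  (forall v, v \in V -> v != 0 ->
     exists w, [/\ w \in W, w != 0 & norm2 (v - w) <= e * norm2 w]) ->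
  max_angle s V W <= 2 * e.
Proof.
move=> s0 dV dW e0 VW; have [e1|e1] := ltP 1 e.
  apply: le_trans (max_angle_lepi2 s0 dV dW) _.
  by have := @pi_le4 R; lra.
pose c := Num.sqrt (1 - e ^+ 2).
have ce : 0 <= 1 - e ^+ 2 by rewrite subr_ge0 expr_le1.
have c2 : c ^+ 2 = 1 - e ^+ 2 by rewrite sqr_sqrtr.
have c0 : 0 <= c by exact: sqrtr_ge0.
have c1 : c <= 1 by rewrite -(@expr_le1 _ 2) // c2 gerBl sqr_ge0.
have c11 : -1 <= c <= 1 by rewrite c1 andbT (le_trans _ c0) // lerN10.
have cWV : within_cosine c W V.
  move=> v vV v1; have [|w [wW w0 wv]] := VW v vV.
    by rewrite -norm2_gt0 v1.
  exists ((norm2 w)^-1 *: w); split; rewrite ?memvZ ?norm2_normalize //.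
  have nw : 0 < norm2 w by rewrite norm2_gt0.
  rewrite dotvZr mulrC ler_pdivlMr //.
  have : norm2 (v - w) ^+ 2 <= (e * norm2 w) ^+ 2.
    by rewrite lerXn2r ?nnegrE ?mulr_ge0 ?norm2_ge0.
  rewrite sqr_norm2 !(dotvBl, dotvBr) (dotvC w v) -!sqr_norm2 v1 => h.
  (* h gives 2 <v,w> >= 1 + c^2 |w|^2, which is at least 2 c |w|. *)
  have := sqr_ge0 (1 - c * norm2 w); nra.
have /(max_angle_le_acos s0 dV dW c0)/le_trans : within_cosine c V W.
  exact: (within_cosine_sym s0).
apply; apply: le_trans (le_2sin _) _.
  by rewrite acos_ge0 // acos_lepi2 ?c0.
by rewrite sin_acos // c2 opprB addrC subrK sqrtr_sqr ger0_norm.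
Qed.

(** The projection onto V along W is bounded: it is read off a left inverse of
    the matrix [VB WB] made of bases of V and W. *)
Lemma disjoint_bounded_below V W : (V :&: W = 0)%VS ->
  exists2 c : R, 0 < c &
    forall v w, v \in V -> w \in W -> norm2 v <= c * norm2 (v - w).
Proof.
move=> VW0.
have [VB bV] := exists_onbasis (erefl (\dim V)).
have [WB bW] := exists_onbasis (erefl (\dim W)).
have PV := memv_onbasisP bV; have PW := memv_onbasisP bW.
have isoV y : norm2 (VB *m y) = norm2 y by apply: norm2_isometry; case: bV.
have isoW y : norm2 (WB *m y) = norm2 y by apply: norm2_isometry; case: bW.
have inV y : VB *m y \in V by apply/PV; exists y; rewrite ?isoV.
have inW y : WB *m y \in W by apply/PW; exists y; rewrite ?isoW.
have [z|L LB] := @mulmx_inj_left_inverse _ _ (row_mx VB WB).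
  rewrite -[z]vsubmxK mul_row_col; set x := usubmx z; set y := dsubmx z => xy.
  have VxWy : VB *m x = WB *m (- y).
    by rewrite mulmxN; apply/eqP; rewrite -addr_eq0 xy.
  have : VB *m x \in (V :&: W)%VS by rewrite memv_cap inV VxWy inW.
  rewrite VW0 memv0 => /eqP Vx0.
  have x0 : x = 0 by apply/eqP; rewrite -norm2_eq0 -isoV Vx0 norm2_eq0.
  have y0 : y = 0.
    apply/eqP; rewrite -norm2_eq0 -isoW norm2_eq0.
    by move: xy; rewrite Vx0 add0r => ->.
  by rewrite x0 y0 col_mx0.
have [c c0 cL] := norm2_mulmx_bounded (usubmx L).
exists (c + 1) => [|v _ /PV[x -> _] /PW[y -> _]]; first by rewrite ltr_wpDl.
have -> : VB *m x - WB *m y = row_mx VB WB *m col_mx x (- y).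
  by rewrite mul_row_col mulmxN.
have xE : x = usubmx L *m (row_mx VB WB *m col_mx x (- y)).
  by rewrite mul_usub_mx mulmxA LB mul1mx col_mxKu.
rewrite isoV {1}xE; apply: le_trans (cL _) _.
by rewrite ler_wpM2r ?norm2_ge0 // lerDl.
Qed.

(** The cosine c of the minimal angle is less than 1 because |v - w| stays away
    from 0 for unit vectors v in V and w in W, and |v - w|^2 = 2 - 2 <v,w>.
    It is nonnegative because w can be replaced by - w. *)
Lemma dotv_le_cos_min_angle V W : (0 < \dim V)%N -> (0 < \dim W)%N ->
  (V :&: W = 0)%VS ->
  exists c, [/\ 0 <= c < 1, min_angle V W = acos c &
    forall v w, v \in V -> w \in W -> dotv v w <= c * (norm2 v * norm2 w)].
Proof.
move=> dV dW VW0; rewrite /min_angle; set E := [set c : R | _].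
have [v0 v0V v01] := exists_unit_vector dV.
have [w0 w0W w01] := exists_unit_vector dW.
have Ev0 : E (dotv v0 w0) by exists v0, w0.
have EN c : E c -> E (- c).
  move=> [v [w [vV wW v1 w1 ->]]]; exists v, (- w); rewrite dotvNr memvN.
  by split=> //; rewrite -scaleN1r norm2Z normrN1 mul1r.
have [b b0 bVW] := disjoint_bounded_below VW0.
have Eub : ubound E (1 - (b ^+ 2)^-1 / 2).
  move=> _ [v [w [vV wW v1 w1 ->]]].
  have b2 : 0 < b ^+ 2 by rewrite exprn_gt0.
  have := bVW v w vV wW; rewrite v1 => le1.
  have : 1 <= (b * norm2 (v - w)) ^+ 2 by rewrite exprn_ege1.
  rewrite exprMn sqr_norm2 !(dotvBl, dotvBr) (dotvC w v) -!sqr_norm2 v1 w1.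
  rewrite mulrC -ler_pdivrMr // mul1r !expr1n; lra.
have hE : has_ubound E by exists (1 - (b ^+ 2)^-1 / 2).
exists (sup E); split=> //.
  apply/andP; split.
    have := ub_le_sup hE Ev0; have := ub_le_sup hE (EN _ Ev0); lra.
  apply: le_lt_trans (ge_sup (ex_intro _ _ Ev0) Eub) _.
  by rewrite ltrBlDr ltrDl divr_gt0 // invr_gt0 exprn_gt0.
move=> v w vV wW.
have [->|vn0] := eqVneq v 0.
  by rewrite dotv0l norm2_0 mul0r mulr0.
have [->|wn0] := eqVneq w 0.
  by rewrite dotv0r norm2_0 !mulr0.
have nv : 0 < norm2 v by rewrite norm2_gt0.
have nw : 0 < norm2 w by rewrite norm2_gt0.
rewrite -ler_pdivrMr ?mulr_gt0 //; apply: ub_le_sup => //.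
exists ((norm2 v)^-1 *: v), ((norm2 w)^-1 *: w).
rewrite !norm2_normalize // !memvZ //; split=> //.
by rewrite dotvZl dotvZr invfM mulrA mulrC.
Qed.

Lemma min_angle_gt0 V W : (0 < \dim V)%N -> (0 < \dim W)%N ->
  (V :&: W = 0)%VS -> 0 < min_angle V W.
Proof.
move=> dV dW VW0.
have [c [/andP[c0 c1] -> _]] := dotv_le_cos_min_angle dV dW VW0.
by rewrite acos_gt0 // c1 andbT (le_trans _ c0) // lerN10.
Qed.

(** The distance from v to W is at least sin (min_angle V W) |v|, and
    t <= 2 sin t. *)
Lemma min_angle_le_dist V W v w : (0 < \dim V)%N -> (0 < \dim W)%N ->
  (V :&: W = 0)%VS -> v \in V -> w \in W ->
  min_angle V W * norm2 v <= 2 * norm2 (v - w).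
Proof.
move=> dV dW VW0 vV wW.
have [c [/andP[c0 c1] -> cVW]] := dotv_le_cos_min_angle dV dW VW0.
have c11 : -1 <= c <= 1 by rewrite (ltW c1) (le_trans _ c0) // lerN10.
have c2 : 0 <= 1 - c ^+ 2 by rewrite subr_ge0 expr_le1 // ltW.
have : acos c <= 2 * Num.sqrt (1 - c ^+ 2).
  by rewrite -sin_acos // le_2sin // acos_ge0 // acos_lepi2 ?c0 ?ltW.
move=> /(ler_wpM2r (norm2_ge0 v))/le_trans; apply.
rewrite -mulrA ler_wpM2l // -(@ler_pXn2r _ 2) ?nnegrE ?mulr_ge0 ?norm2_ge0
  ?sqrtr_ge0 //.
rewrite exprMn sqr_sqrtr // [leRHS]sqr_norm2.
rewrite !(dotvBl, dotvBr) (dotvC w v) -!sqr_norm2.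
have := cVW v w vV wW; have := sqr_ge0 (c * norm2 v - norm2 w); nra.
Qed.

End PrincipalAngles.

(** * Lower and upper limits of asymptotically equal sequences *)

Section LimSup.
Context {R : realType}.
Implicit Types u v : R^nat.

Lemma limn_sup_le u v : bounded_fun u -> bounded_fun v ->
  (forall e, 0 < e -> exists N, forall n, (N <= n)%N -> u n <= v n + e) ->
  limn_sup u <= limn_sup v.
Proof.
move=> bu bv uv; rewrite !limn_supE //; apply/ler_addgt0Pr => e e0.
rewrite -lerBlDr; apply: lb_le_inf; first by exists (sups v 0%N), 0%N.
move=> _ [m _ <-]; have [N uvN] := uv e e0; rewrite lerBlDr.
pose M := maxn N m.
apply: (@le_trans _ _ (sups u M)).
  by apply: ge_inf; [exact: bounded_fun_has_lbound_sups|exists M].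
apply: (@le_trans _ _ (sups v M + e)); last first.
  rewrite lerD2r nonincreasing_sups ?leq_maxr //.
  exact: bounded_fun_has_ubound.
apply: ge_sup; first by exists (u M), M => /=.
move=> _ [n /= Mn <-]; apply: (le_trans (uvN n _)).
  exact: leq_trans (leq_maxl _ _) Mn.
rewrite lerD2r; apply: ub_le_sup; last by exists n.
exact/has_ubound_sdrop/bounded_fun_has_ubound.
Qed.

Lemma limn_inf_le u v : bounded_fun u -> bounded_fun v ->
  (forall e, 0 < e -> exists N, forall n, (N <= n)%N -> u n <= v n + e) ->
  limn_inf u <= limn_inf v.
Proof.
move=> bu bv uv; rewrite !limn_infE //; apply/ler_addgt0Pr => e e0.
apply: ge_sup; first by exists (infs u 0%N), 0%N.
move=> _ [m _ <-]; have [N uvN] := uv e e0.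
pose M := maxn N m.
apply: (@le_trans _ _ (infs v M + e)); last first.
  rewrite lerD2r.
  by apply: ub_le_sup; [exact: bounded_fun_has_ubound_infs|exists M].
apply: (@le_trans _ _ (infs u M)).
  rewrite nondecreasing_infs ?leq_maxr //.
  exact: bounded_fun_has_lbound.
rewrite -lerBlDr; apply: lb_le_inf; first by exists (v M), M => /=.
move=> _ [n /= Mn <-]; rewrite lerBlDr; apply: le_trans (uvN n _); last first.
  exact: leq_trans (leq_maxl _ _) Mn.
apply: ge_inf; last by exists n.
exact/has_lbound_sdrop/bounded_fun_has_lbound.
Qed.

End LimSup.

(** * Fibers of the dichotomy *)

Section NestedProjectors.
Context {R : realType} {d : nat}.
Implicit Types Q : 'M[R]_d.

Lemma memv_mxrange_idem Q x : Q *m Q = Q -> (x \in mxrange Q) = (Q *m x == x).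
Proof.
move=> QQ; apply/memv_mxrangeP/eqP => [[y ->]|<-]; last by exists x.
by rewrite mulmxA QQ.
Qed.

Lemma mxrange_null_disjoint Q : Q *m Q = Q -> (mxrange Q :&: mxnull Q = 0)%VS.
Proof.
move=> QQ; apply/eqP; rewrite -subv0; apply/subvP => x.
rewrite memv_cap memv_mxrange_idem // memv_mxnull => /andP[/eqP Qx /eqP Qx0].
by rewrite -Qx Qx0 mem0v.
Qed.

(** For x in the range of Q, write x = (x - Q' x) + Q' x. *)
Lemma mxrange_split Q Q' : Q' *m Q' = Q' -> (mxrange Q' <= mxrange Q)%VS ->
  (mxrange Q = mxrange Q :&: mxnull Q' + mxrange Q')%VS.
Proof.
move=> Q'Q' sub; apply/eqP; rewrite eqEsubv subv_add capvSl sub !andbT.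
apply/subvP => x xQ; rewrite -(subrK (Q' *m x) x) memv_add //; last first.
  by apply/memv_mxrangeP; exists x.
rewrite memv_cap memv_mxnull mulmxBr mulmxA Q'Q' subrr eqxx andbT.
by rewrite memvB //; apply: (subvP sub); apply/memv_mxrangeP; exists x.
Qed.

(** For x in the null space of Q', write x = (x - Q x) + Q x. *)
Lemma mxnull_split Q Q' : Q *m Q = Q -> (mxnull Q <= mxnull Q')%VS ->
  (mxnull Q' = mxnull Q + mxrange Q :&: mxnull Q')%VS.
Proof.
move=> QQ sub; apply/eqP; rewrite eqEsubv subv_add capvSr sub !andbT.
have nullB x : x - Q *m x \in mxnull Q.
  by rewrite memv_mxnull mulmxBr mulmxA QQ subrr.
apply/subvP => x xQ; rewrite -(subrK (Q *m x) x) memv_add //.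
rewrite memv_cap; apply/andP; split; first by apply/memv_mxrangeP; exists x.
have -> : Q *m x = x - (x - Q *m x) by rewrite opprB addrC subrK.
by rewrite memvB // (subvP sub).
Qed.

Lemma dim_mxnull_split Q Q' : Q *m Q = Q -> (mxnull Q <= mxnull Q')%VS ->
  \dim (mxnull Q') = (\dim (mxnull Q) + \dim (mxrange Q :&: mxnull Q'))%N.
Proof.
move=> QQ sub; rewrite {1}(mxnull_split QQ sub) dimv_disjoint_sum //.
apply/eqP; rewrite -subv0 -(mxrange_null_disjoint QQ) subv_cap capvSl andbT.
by rewrite (subv_trans (capvSr _ _)) ?capvSl.
Qed.

End NestedProjectors.

Section DichotomyFibers.
Context {R : realType} {d : nat}.
Context (A : nat -> 'M[R]_d) (k : nat) (sm sp : nat -> R).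
Context (P : nat -> nat -> 'M[R]_d) (dich : dichotomy_data A k sm sp P).

Lemma fiber_sum_null n j : (j <= k)%N ->
  fiber_sum P n 1 j = mxnull (P n j.+1).
Proof.
elim: j => [|j IHj] jk.
  by rewrite /fiber_sum big_geq // (dd_null1 dich).
rewrite /fiber_sum big_nat_recr //= -/(fiber_sum P n 1 j) IHj 1?ltnW //.
rewrite [RHS](@mxnull_split _ _ (P n j.+1)) ?(dd_proj dich) ?(dd_null dich) //.
exact: leqW.
Qed.

Lemma dim_mxnull_fibers n j : (j <= k)%N ->
  \dim (mxnull (P n j.+1)) = (\sum_(1 <= i < j.+1) \dim (fiber P n i))%N.
Proof.
elim: j => [|j IHj] jk.
  by rewrite big_geq // (dd_null1 dich) dimv0.
rewrite big_nat_recr //= -IHj 1?ltnW //.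
by rewrite [LHS](@dim_mxnull_split _ _ (P n j.+1)) ?(dd_proj dich)
  ?(dd_null dich) //; exact: leqW.
Qed.

Lemma fiber_sum_range n j : (j <= k)%N ->
  fiber_sum P n j.+1 k = mxrange (P n j.+1).
Proof.
move=> jk; rewrite -(subKn jk); elim: (k - j)%N (leq_subr j k) => [|m IHm] mk.
  by rewrite subn0 /fiber_sum big_geq // (dd_range0 dich).
have jE : (k - m.+1).+1 = (k - m)%N by rewrite subnSK.
rewrite /fiber_sum jE big_ltn ?ltnS ?leq_subr // -/(fiber_sum P n (k - m).+1 k).
have km : (1 <= k - m <= k)%N by rewrite subn_gt0 mk leq_subr.
rewrite IHm 1?ltnW // -mxrange_split ?(dd_proj dich) ?(dd_range dich) //.
by case/andP: km => _ km; rewrite ltnS.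
Qed.

Lemma dichotomy_sp_ge0 j : (j <= k)%N -> 0 <= sp j.+1.
Proof.
move=> jk; rewrite -(subKn jk); elim: (k - j)%N (leq_subr j k) => [|m IHm] mk.
  by rewrite subn0 (dd_sp0 dich).
have /(dd_lt dich)/andP[lt1 lt2] : (1 <= k - m <= k)%N.
  by rewrite subn_gt0 mk leq_subr.
rewrite subnSK //; apply: le_trans lt2; apply: le_trans (ltW lt1).
by rewrite IHm // ltnW.
Qed.

End DichotomyFibers.

(** * Attraction towards the dominant fibers *)

Section SolutionOperator.
Context {R : realType} {d : nat}.
Context (A : nat -> 'M[R]_d).

Lemma PhiS n : Phi A n.+1 0 = A n *m Phi A n 0.
Proof.
rewrite /Phi !leq0n /index_iota !subn0 -addn1 iotaD rev_cat big_cat /=.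
by rewrite big_seq1 -mulmxE add0n.
Qed.

Lemma Phi0n n : Phi A 0 n = \prod_(0 <= i < n) invmx (A i).
Proof. by case: n => [|n] //=; rewrite /Phi /= /index_iota /= !big_nil. Qed.

Context (A_unit : forall n, A n \in unitmx).

Lemma PhiK n : Phi A 0 n *m Phi A n 0 = 1%:M.
Proof.
elim: n => [|n IHn].
  by rewrite /Phi /= /index_iota /= big_nil mul1mx.
rewrite PhiS Phi0n big_nat_recr //= -Phi0n -mulmxE -mulmxA.
by rewrite (mulmxA (invmx _)) mulVmx // mul1mx.
Qed.

Lemma mulmx_Phi_inj n : injective (mulmx (Phi A n 0) : 'cV[R]_d -> 'cV[R]_d).
Proof.
apply: (can_inj (g := mulmx (Phi A 0 n))) => x.
by rewrite mulmxA PhiK mul1mx.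
Qed.

Lemma dim_mximage_Phi n (V : {vspace 'cV[R]_d}) :
  \dim (mximage (Phi A n 0) V) = \dim V.
Proof.
apply: limg_dim_eq; apply/eqP; rewrite -subv0; apply/subvP => x.
rewrite memv_cap memv_mxnull memv0 => /andP[_ /eqP Px].
by apply/eqP/(@mulmx_Phi_inj n); rewrite Px mulmx0.
Qed.

Lemma mximage_Phi_null n (Q0 Qn : 'M[R]_d) :
  Phi A n 0 *m Q0 = Qn *m Phi A n 0 ->
  mximage (Phi A n 0) (mxnull Q0) = mxnull Qn.
Proof.
move=> inv; apply/vspaceP => x; rewrite memv_mxnull.
apply/memv_mximageP/eqP => [[y + ->]|Qx].
  by rewrite memv_mxnull mulmxA -inv -mulmxA => /eqP->; rewrite mulmx0.
have xE : Phi A n 0 *m (Phi A 0 n *m x) = x.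
  by rewrite mulmxA (mulmx1C (PhiK n)) mul1mx.
exists (Phi A 0 n *m x); rewrite ?xE // memv_mxnull; apply/eqP.
by apply: (@mulmx_Phi_inj n); rewrite mulmxA inv -mulmxA xE Qx mulmx0.
Qed.

(** Split v along the projector: the part in the range of Q 0 grows at most like
    a^n, the part y in its null space at least like b^n, and the minimal angle
    bounds |v| by (2 / min_angle) |y|.  So the image of v is a point p of the
    null space of Q n plus an error that is small compared with p. *)
Lemma max_angle_Phi_le (Q : nat -> 'M[R]_d) (K a b : R) n s
    (V : {vspace 'cV[R]_d}) :
  (0 < s)%N -> 0 < K -> 0 <= a -> 0 < b ->
  Q 0%N *m Q 0%N = Q 0%N -> Phi A n 0 *m Q 0%N = Q n *m Phi A n 0 ->
  specnorm (Phi A n 0 *m Q 0%N) <= K * a ^+ n ->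
  specnorm (Phi A 0 n *m (1%:M - Q n)) <= K * b ^- n ->
  \dim V = s -> \dim (mxnull (Q 0%N)) = s -> (0 < \dim (mxrange (Q 0%N)))%N ->
  (V :&: mxrange (Q 0%N) = 0)%VS ->
  max_angle s (mximage (Phi A n 0) V) (mxnull (Q n)) <=
    4 * K ^+ 2 / min_angle V (mxrange (Q 0%N)) * (a / b) ^+ n.
Proof.
move=> s0 K0 a0 b0 QQ inv stab unst dV dN dQ VQ0.
set theta := min_angle _ _.
have dV0 : (0 < \dim V)%N by rewrite dV.
have th0 : 0 < theta by exact: min_angle_gt0.
rewrite (_ : _ * _ = 2 * (2 * K ^+ 2 / theta * (a / b) ^+ n)); last by ring.
apply: max_angle_le_graph => //.
- by rewrite dim_mximage_Phi.
- by rewrite -(mximage_Phi_null inv) dim_mximage_Phi.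
- by rewrite !mulr_ge0 ?invr_ge0 ?exprn_ge0 ?mulr_ge0 ?invr_ge0 ?(ltW K0)
    ?(ltW th0) ?(ltW b0).
move=> _ /memv_mximageP[v vV ->] v0.
have vn0 : v != 0 by apply: contraNneq v0 => ->; rewrite mulmx0.
set y := v - Q 0%N *m v; set p := Phi A n 0 *m y.
have vy : theta * norm2 v <= 2 * norm2 y.
  by apply: min_angle_le_dist => //; apply/memv_mxrangeP; exists v.
have Qp : Q n *m p = 0.
  by rewrite /p mulmxA -inv -mulmxA mulmxBr mulmxA QQ subrr mulmx0.
have py : norm2 y <= K * b ^- n * norm2 p.
  have -> : y = Phi A 0 n *m (1%:M - Q n) *m p.
    by rewrite -mulmxA mulmxBl mul1mx Qp subr0 mulmxA PhiK mul1mx.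
  apply: le_trans (norm2_mulmx_le _ _) _.
  by rewrite ler_wpM2r ?norm2_ge0.
exists p; split.
- by rewrite memv_mxnull Qp.
- apply/eqP => p0; move: py; rewrite p0 norm2_0 mulr0 => y0.
  have : 0 < theta * norm2 v by rewrite mulr_gt0 ?norm2_gt0.
  by rewrite ltNge (le_trans vy) // pmulr_rle0.
have -> : Phi A n 0 *m v - p = Phi A n 0 *m Q 0%N *m v.
  by rewrite /p mulmxBr opprB addrC subrK mulmxA.
apply: le_trans (norm2_mulmx_le _ _) _.
apply: le_trans (ler_wpM2r (norm2_ge0 v) stab) _.
rewrite -(ler_pM2l th0).
rewrite (_ : theta * (K * a ^+ n * norm2 v) =
             K * a ^+ n * (theta * norm2 v)); last by ring.
have Ka : 0 <= K * a ^+ n by rewrite mulr_ge0 ?exprn_ge0 ?(ltW K0).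
apply: le_trans (ler_wpM2l Ka vy) _.
rewrite [leRHS](_ : _ = K * a ^+ n * (2 * (K * b ^- n * norm2 p))).
  by rewrite ler_wpM2l // ler_wpM2l.
by rewrite expr_div_n; field; rewrite expf_neq0 gt_eqF.
Qed.

End SolutionOperator.

(** * Angular averages *)

Section AngularAverages.
Context {R : realType}.

Lemma geometric_sum_le (r : R) n : 0 <= r < 1 ->
  \sum_(1 <= i < n.+1) r ^+ i.-1 <= (1 - r)^-1.
Proof.
move=> /andP[r0 r1]; have r1' : 0 < 1 - r by rewrite subr_gt0.
suff -> : \sum_(1 <= i < n.+1) r ^+ i.-1 = (1 - r ^+ n) / (1 - r).
  by rewrite ler_piMl ?invr_ge0 ?(ltW r1') // gerBl exprn_ge0.
elim: n => [|n IHn]; first by rewrite big_geq // expr0 subrr mul0r.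
rewrite big_nat_recr //= IHn exprS; field.
by rewrite gt_eqF.
Qed.

Lemma average_dist_le (C r : R) (x y : nat -> R) n : 0 <= C -> 0 <= r < 1 ->
  (forall i, (0 < i)%N -> `|x i - y i| <= C * r ^+ i.-1 + C * r ^+ i) ->
  `|n%:R^-1 * \sum_(1 <= i < n.+1) x i - n%:R^-1 * \sum_(1 <= i < n.+1) y i|
    <= n%:R^-1 * (2 * C / (1 - r)).
Proof.
move=> C0 r01 xy; rewrite -mulrBr normrM ger0_norm ?invr_ge0 //.
rewrite ler_wpM2l ?invr_ge0 // -sumrB.
apply: le_trans (ler_norm_sum _ _ _) _.
apply: (@le_trans _ _ (\sum_(1 <= i < n.+1) 2 * C * r ^+ i.-1)).
  apply: ler_sum_nat => i /andP[i0 _]; apply: le_trans (xy i i0) _.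
  rewrite -mulrA mulr2n mulrDl !mul1r lerD2l ler_wpM2l //.
  case/andP: r01 => r0 r1; rewrite -[in leLHS](prednK i0) exprS.
  by rewrite ler_piMl ?exprn_ge0 // ltW.
rewrite -mulr_sumr ler_wpM2l ?mulr_ge0 //; exact: geometric_sum_le.
Qed.

Lemma alpha_disc_bounded d (A : nat -> 'M[R]_d) s (V : {vspace 'cV[R]_d}) :
  (forall n, A n \in unitmx) -> (0 < s)%N -> \dim V = s ->
  bounded_fun (fun n => alpha_disc A s n V).
Proof.
move=> Au s0 dV; exists (pi / 2); split; first by rewrite num_real.
move=> M piM n _ /=; apply: le_trans (ltW piM).
have dP i : \dim (mximage (Phi A i 0) V) = s by rewrite dim_mximage_Phi.
rewrite /alpha_disc ger0_norm; last first.
  rewrite mulr_ge0 ?invr_ge0 // sumr_ge0 // => i _.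
  exact: max_angle_ge0.
case: n => [|n]; first by rewrite big_geq // mulr0 divr_ge0 ?pi_ge0.
rewrite mulrC ler_pdivrMr ?ltr0Sn //.
apply: le_trans (ler_sum _ (fun i _ => max_angle_lepi2 s0 (dP _) (dP _))) _.
by rewrite sumr_const_nat subn1 /= mulr_natr.
Qed.

Lemma I_disc_eq d (A : nat -> 'M[R]_d) s (V W : {vspace 'cV[R]_d}) (C : R) :
  (forall n, A n \in unitmx) -> (0 < s)%N -> \dim V = s -> \dim W = s ->
  (forall n, (1 <= n)%N ->
    `|alpha_disc A s n V - alpha_disc A s n W| <= C / n%:R) ->
  I_disc A s V = I_disc A s W.
Proof.
move=> Au s0 dV dW VW.
have near0 (e : R) : 0 < e -> exists N, forall n, (N <= n)%N ->
    `|alpha_disc A s n V - alpha_disc A s n W| <= e.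
  move=> e0; have [N CN] : exists N, C / e < N%:R.
    exists (Num.bound `|C / e|).
    exact: le_lt_trans (ler_norm _) (archi_boundP (normr_ge0 _)).
  exists (maxn N 1) => n; rewrite geq_max => /andP[Nn n1].
  apply: le_trans (VW n n1) _.
  rewrite ler_pdivrMr ?ltr0n // mulrC -ler_pdivrMr // ltW //.
  by apply: lt_le_trans CN _; rewrite ler_nat.
have bV := alpha_disc_bounded Au s0 dV; have bW := alpha_disc_bounded Au s0 dW.
have VleW e : 0 < e -> exists N, forall n, (N <= n)%N ->
    alpha_disc A s n V <= alpha_disc A s n W + e.
  move=> /near0[N HN]; exists N => n /HN; rewrite ler_norml => /andP[_].
  by rewrite lerBlDl.
have WleV e : 0 < e -> exists N, forall n, (N <= n)%N ->
    alpha_disc A s n W <= alpha_disc A s n V + e.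
  move=> /near0[N HN]; exists N => n /HN; rewrite ler_norml => /andP[+ _].
  by rewrite lerNl opprB lerBlDl.
have infE := le_anti (introT andP
  (conj (limn_inf_le bV bW VleW) (limn_inf_le bW bV WleV))).
have supE := le_anti (introT andP
  (conj (limn_sup_le bV bW VleW) (limn_sup_le bW bV WleV))).
by rewrite /I_disc infE supE.
Qed.

End AngularAverages.

Theorem proposition3p3 (R : realType) (d : nat) (A : nat -> 'M[R]_d)
  (A_unit : forall n, A n \in unitmx)
  (A_bounded : has_ubound (range (fun n => specnorm (A n))))
  (A_inv_bounded : has_ubound (range (fun n => specnorm (invmx (A n)))))
  (k : nat) (sm sp : nat -> R) (P : nat -> nat -> 'M[R]_d)
  (dich : dichotomy_data A k sm sp P)
  (s j : nat) (hs : (0 < s < d)%N) (hj : (1 <= j <= k)%N) :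
  exists C r : R, [/\ 0 < C, 0 <= r < 1 &
    forall V : {vspace 'cV[R]_d},
      \dim V = s ->
      s = (\sum_(1 <= i < j.+1) \dim (fiber P 0 i))%N ->
      (V :&: fiber_sum P 0 j.+1 k)%VS = 0%VS ->
      let theta_min := min_angle V (fiber_sum P 0 j.+1 k) in
      [/\ forall n, (1 <= n)%N ->
            max_angle s (mximage (Phi A n 0) V) (fiber_sum P n 1 j)
              <= C / theta_min * r ^+ n,
          forall n, (1 <= n)%N ->
            `|alpha_disc A s n V - alpha_disc A s n (fiber_sum P 0 1 j)|
              <= C / (n%:R * theta_min) &
          I_disc A s V = I_disc A s (fiber_sum P 0 1 j)]].
Proof.
have [/andP[s0 sd] /andP[j1 jk]] := (hs, hj).
have /andP[gap _] := dd_lt dich hj.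
have sp0 := dichotomy_sp_ge0 dich jk.
(* Moving both rates by a quarter of the gap keeps a < b. *)
pose e := (sm j - sp j.+1) / 4.
have e0 : 0 < e < sm j - sp j.+1 by rewrite /e; apply/andP; split; lra.
have [K0 bound] := dd_bound dich hj e0.
set a := sp j.+1 + e in bound; set b := sm j - e in bound.
have a0 : 0 <= a by rewrite /a /e; lra.
have b0 : 0 < b by rewrite /b /e; lra.
have ab : a < b by rewrite /a /b /e; lra.
(* The dichotomy constant may be any real number; make it positive. *)
pose K := `|K0| + 1; have K_gt0 : 0 < K by rewrite ltr_wpDl.
have K0K x : 0 <= x -> K0 * x <= K * x.
  by move=> x0; rewrite ler_wpM2r // (le_trans (ler_norm _)) // lerDl.
pose r := a / b; have r01 : 0 <= r < 1.
  by rewrite divr_ge0 ?(ltW b0) //= ltr_pdivrMr // mul1r.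
have r1 : 0 < 1 - r by rewrite subr_gt0; case/andP: r01.
pose C0 := 4 * K ^+ 2; have C00 : 0 < C0 by rewrite mulr_gt0 ?exprn_gt0.
exists (2 * C0 / (1 - r)), r; split=> //; first by rewrite divr_gt0 ?mulr_gt0.
move=> V dV sE; rewrite (fiber_sum_range dich) // => VQ0 theta.
pose Q n := P n j.+1; rewrite -/(Q 0%N) in VQ0 theta *.
have QQ : Q 0%N *m Q 0%N = Q 0%N by rewrite (dd_proj dich) // ltnS jk.
have inv n : Phi A n 0 *m Q 0%N = Q n *m Phi A n 0.
  by rewrite (dd_inv dich) // ltnS jk.
have dN : \dim (mxnull (Q 0%N)) = s.
  by rewrite (dim_mxnull_fibers dich) // -sE.
have dQ : (0 < \dim (mxrange (Q 0%N)))%N.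
  have := limg_ker_dim (mxlin (Q 0%N)) fullv.
  rewrite -/(mxrange (Q 0%N)) capfv -/(mxnull (Q 0%N)) dN dimvf /dim /= muln1.
  move=> sdE; rewrite lt0n; apply: contraTneq sd => dQ0.
  by rewrite -sdE dQ0 addn0 ltnn.
have th0 : 0 < theta by apply: min_angle_gt0 => //; rewrite dV.
have angle n : max_angle s (mximage (Phi A n 0) V) (mxnull (Q n)) <=
    C0 / theta * r ^+ n.
  have [stab unst] := bound _ _ (leq0n n); rewrite subn0 in stab unst.
  apply: max_angle_Phi_le => //.
    by apply: le_trans stab _; rewrite K0K ?exprn_ge0.
  by apply: le_trans unst _; rewrite K0K ?invr_ge0 ?exprn_ge0 ?ltW.
have imN n : mximage (Phi A n 0) (fiber_sum P 0 1 j) = mxnull (Q n).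
  by rewrite (fiber_sum_null dich) // (mximage_Phi_null A_unit (inv n)).
have dPV n : \dim (mximage (Phi A n 0) V) = s by rewrite dim_mximage_Phi.
have dQn n : \dim (mxnull (Q n)) = s.
  by rewrite -(mximage_Phi_null A_unit (inv n)) dim_mximage_Phi.
have C0th : 0 <= C0 / theta by rewrite divr_ge0 ?ltW.
have average n : `|alpha_disc A s n V - alpha_disc A s n (fiber_sum P 0 1 j)| <=
    n%:R^-1 * (2 * (C0 / theta) / (1 - r)).
  apply: average_dist_le => // i _; rewrite !imN.
  set V1 := mximage (Phi A i.-1 0) V; set V2 := mximage (Phi A i 0) V.
  have d1 : \dim V1 = s := dPV i.-1; have d2 : \dim V2 = s := dPV i.
  have m1 := angle i.-1; have m2 := angle i; rewrite -/V1 -/V2 in m1 m2.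
  (* From V1 to V2 by way of N(Q (i-1)) and N(Q i); and from N(Q (i-1)) to
     N(Q i) by way of V1 and V2. *)
  have t1 := max_angle_triangle s0 d1 (dQn i.-1) d2.
  have t2 := max_angle_triangle s0 (dQn i.-1) (dQn i) d2.
  have t3 := max_angle_triangle s0 (dQn i.-1) d1 (dQn i).
  have t4 := max_angle_triangle s0 d1 d2 (dQn i).
  rewrite (max_angleC s0 (dQn i) d2) in t2.
  rewrite (max_angleC s0 (dQn i.-1) d1) in t3.
  rewrite ler_norml; clear - m1 m2 t1 t2 t3 t4; move: m1 m2 t1 t2 t3 t4.
  move: (max_angle s V1 V2) (max_angle s (mxnull (Q i.-1)) (mxnull (Q i))).
  move: (max_angle s V1 _) (max_angle s V2 _) (max_angle s V1 _).
  move: (max_angle s _ V2) (C0 / theta * r ^+ i.-1) (C0 / theta * r ^+ i).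
  by move=> *; apply/andP; split; lra.
split=> [n n1|n n1|].
- rewrite (fiber_sum_null dich) //; apply: le_trans (angle n) _.
  rewrite ler_wpM2r ?exprn_ge0 //; first by case/andP: r01.
  rewrite ler_wpM2r ?invr_ge0 ?(ltW th0) //.
  rewrite ler_pdivlMr //; case/andP: r01 => r0 _; nra.
- apply: le_trans (average n) _; rewrite le_eqVlt; apply/orP; left; apply/eqP.
  by field; rewrite !gt_eqF ?ltr0n.
- apply: (@I_disc_eq _ _ _ _ _ _ (2 * (C0 / theta) / (1 - r))) => //.
    by rewrite (fiber_sum_null dich).
  by move=> n _; rewrite mulrC average.
Qed.
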